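(* For every integer $n\geq 4$, there is a 3-tournament on $n$ vertices that has at least $\frac{1}{4}\binom{n}{4}$ directed tetrahedra.
   Context: Orientations of finite sets are defined inductively. An orientation of a 1-set $\{x\}$ is an assignment of $+1$ or $-1$ to $x$. An orientation of a 2-set $\{a,b\}$ is a directed edge from $a$ to $b$ or from $b$ to $a$ (a directed edge from $a$ to $b$ is regarded as assigning $+1$ to $b$ and $-1$ to $a$). For $d\ge 3$, an orientation of a $d$-set consists of an orientation of each of its $(d-1)$-subsets such that these are pairwise compatible, where two oriented $(d-1)$-sets sharing a common $(d-2)$-subset are compatible if they give different orientations to that common $(d-2)$-subset. Thus an orientation of a 3-set is the same as a cyclic ordering of it, and each cyclic ordering induces a direction on each of its 2-subsets. A 3-tournament on $n$ vertices is a set of $n$ vertices together with an orientation of each of its 3-subsets. A tetrahedron is a 4-subset of the vertex set. A tetrahedron is directed if its four oriented 3-subsets are pairwise compatible, i.e. any two of its 3-subsets have cyclic orderings that induce opposite directions on their common 2-subset. *)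

(* Defs.v *)
From mathcomp Require Import all_boot all_order all_algebra.

Set Implicit Arguments.
Unset Strict Implicit.
Unset Printing Implicit Defensive.

Import GRing.Theory.
Local Open Scope ring_scope.

Definition subsets_of_card (T : finType) (d : nat) (S : {set T}) :
  {set {set T}} := [set A : {set T} | (A \subset S) && (#|A| == d)].

(* A directed edge from a to b is the ordered pair (a, b). *)
Definition orients2 (T : finType) (A : {set T}) (e : T * T) : bool :=
  (#|A| == 2%N) && (A == [set e.1; e.2]).

(* The orientation of {x} given by a directed edge e having x as an end;
   meaningful only when x is e.1 or e.2. *)
Definition edge_sign (T : finType) (e : T * T) (x : T) : int :=
  if x == e.2 then 1 else -1.

Definition compatible2 (T : finType) (A : {set T}) (e : T * T)
    (B : {set T}) (f : T * T) : bool :=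
  [forall x : T, (A :&: B == [set x]) ==> (edge_sign e x != edge_sign f x)].

(* An orientation of a 3-set S is a family of directed edges indexed by the
   2-subsets of S; the values of o elsewhere are irrelevant. *)
Definition orients3 (T : finType) (S : {set T}) (o : {set T} -> T * T) : bool :=
  [&& #|S| == 3%N,
      [forall A in subsets_of_card 2 S, orients2 A (o A)]
    & [forall A in subsets_of_card 2 S, forall B in subsets_of_card 2 S,
        (A != B) ==> compatible2 A (o A) B (o B)]].

Definition compatible3 (T : finType) (S : {set T}) (o : {set T} -> T * T)
    (S' : {set T}) (o' : {set T} -> T * T) : bool :=
  (#|S :&: S'| == 2%N) ==> (o (S :&: S') != o' (S :&: S')).

Record tournament3 (T : finType) : Type := Tournament3 {
  orientation3 :> {set T} -> {set T} -> T * T;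
  orientation3P : forall S : {set T}, #|S| = 3%N -> orients3 S (orientation3 S)
}.

Definition directed_tetrahedron (T : finType) (t : tournament3 T)
    (Q : {set T}) : bool :=
  (#|Q| == 4%N) &&
  [forall S in subsets_of_card 3 Q, forall S' in subsets_of_card 3 Q,
     (S != S') ==> compatible3 S (t S) S' (t S')].

Definition directed_tetrahedra (T : finType) (t : tournament3 T) :
  {set {set T}} := [set Q : {set T} | directed_tetrahedron t Q].

(* Main.v *)
Require Import Defs.
From mathcomp Require Import all_boot all_order all_algebra.

(** The tournament is found by averaging.  An ordinary tournament [arc] on the
    vertices yields a 3-tournament: a cyclic triple x, y, z is positively
    oriented when an odd number of the arcs xy, yz, zx point forward.  Two
    triples x, y, z and x, y, w of a tetrahedron are then compatible exactly
    when the closed walk x, z, y, w has an odd number of forward arcs, since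
    the contributions of xy cancel.  So the tetrahedron is directed as soon as
    its three 4-cycles are all odd.

    Each of the six edges lies on two of the 4-cycles, so the sum of the three
    parities does not depend on the arcs; it is odd, as the transitive order
    shows.  Hence none or two of the 4-cycles are even.  Two 4-cycles have two
    opposite edges in common, one of which is at a given vertex a, and
    reversing that one repairs both.  So for every tournament, either no change
    or the reversal of one of the three edges at a makes the tetrahedron
    directed ([exists_flip_directed]).  These four changes are bijections of
    the set of tournaments, so each tetrahedron is directed for at least a
    quarter of all tournaments ([card_directed_codes]); some tournament
    therefore makes at least a quarter
    of the tetrahedra directed.  Independent random orientations of the triples
    would give only one eighth. *)

Set Implicit Arguments.
Unset Strict Implicit.
Unset Printing Implicit Defensive.

(** * Finite sets and counting *)

Lemma uniq3 (T : eqType) (a b c : T) :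
  uniq [:: a; b; c] = [&& a != b, a != c & b != c].
Proof. by rewrite /= !inE negb_or andbT -andbA. Qed.

Lemma cards3P (T : finType) (S : {set T}) :
  #|S| = 3 -> exists a b c, uniq [:: a; b; c] /\ S = [set a; b; c].
Proof.
move=> S3; have /set0Pn[a Sa] : S != set0 by rewrite -card_gt0 S3.
have := cardsD1 a S; rewrite Sa S3 => -[/esym/eqP/cards2P[b [c [nbc eS]]]].
have: b \in S :\ a by rewrite eS !inE eqxx.
have: c \in S :\ a by rewrite eS !inE eqxx orbT.
rewrite !inE => /andP[nca _] /andP[nba _].
exists a, b, c; split; last by rewrite -setUA -eS setD1K.
by rewrite uniq3 ![a == _]eq_sym nba nca nbc.
Qed.

Lemma set3D2 (T : finType) (a b c : T) :
  a != c -> b != c -> [set a; b; c] :\: [set a; b] = [set c].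
Proof.
move=> nac nbc; rewrite setDUl setDv set0U; apply/setDidPl.
by rewrite disjoints1 !inE negb_or !(eq_sym c) nac.
Qed.

Lemma subsets2_of3 (T : finType) (a b c : T) (A : {set T}) :
  A \in subsets_of_card 2 [set a; b; c] ->
  [\/ A = [set a; b], A = [set b; c] | A = [set c; a]].
Proof.
rewrite inE => /andP[sA /cards2P[x [y [nxy eA]]]]; move: sA; rewrite {A}eA.
rewrite subUset !sub1set !inE -!orbA => /andP[/or3P[]/eqP ex /or3P[]/eqP ey];
  move: nxy; rewrite ex ey ?eqxx // => _;
  by [constructor 1 | constructor 2 | constructor 3
     | constructor 1; rewrite setUC | constructor 2; rewrite setUC
     | constructor 3; rewrite setUC].
Qed.

(** The preimages of [P] under the [#|A|] maps cover [G], and each has the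
    cardinality of [P]. *)
Lemma leq_card_translates (G I : finType) (A : {set I}) (P : {set G})
    (h : I -> G -> G) :
    (forall i, injective (h i)) ->
    (forall g, exists2 i, i \in A & h i g \in P) ->
  #|G| <= #|A| * #|P|.
Proof.
move=> hI cov; have -> : #|G| = \sum_(g : G) 1 by rewrite sum1_card.
apply: (@leq_trans (\sum_(g : G) \sum_(i in A) (h i g \in P))).
  by apply: leq_sum => g _; have [i Ai Pi] := cov g; rewrite (bigD1 i) //= Pi.
rewrite exchange_big /= -sum_nat_const; apply: leq_sum => i _.
rewrite -(card_preimset P (hI i)) -sum1_card [X in _ <= X]big_mkcond /=.
by apply: leq_sum => g _; rewrite inE; case: (_ \in P).
Qed.

(** * 3-tournaments from signs of ordered triples *)

Definition cyclic_sign (T : eqType) (o : T -> T -> T -> bool) : Prop :=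
  (forall x y z, o x y z = o y z x) /\
  (forall x y z, uniq [:: x; y; z] -> o y x z = ~~ o x y z).

(** The edge is picked by its properties because a 2-set carries no order of
    its elements; the default pair [(x0, x0)] is returned only when [A] is not
    a 2-subset of a 3-set [S]. *)
Definition induced_edge (T : finType) (x0 : T) (o : T -> T -> T -> bool)
    (S A : {set T}) : T * T :=
  odflt (x0, x0) [pick e : T * T |
    (A == [set e.1; e.2]) && [exists z in S :\: A, o e.1 e.2 z]].

Lemma induced_edgeE (T : finType) (x0 : T) o (S : {set T}) (a b c : T) :
    cyclic_sign o -> a != b -> S :\: [set a; b] = [set c] -> o a b c ->
  induced_edge x0 o S [set a; b] = (a, b).
Proof.
move=> [_ oN] nab eS oabc; rewrite /induced_edge eS.
have: c \in S :\: [set a; b] by rewrite eS set11.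
rewrite !inE negb_or => /andP[/andP[nca ncb] _].
case: pickP => [[x y] /= /andP[/eqP exy /exists_inP[z /set1P->]] oxyc | none].
  have nxy: x != y.
    by have := cards2 x y; rewrite -exy cards2 nab; case: (x == y).
  have: x \in [set a; b] by rewrite exy !inE eqxx.
  have: y \in [set a; b] by rewrite exy !inE eqxx orbT.
  move: nxy oxyc; rewrite !inE => + + /orP[]/eqP ey /orP[]/eqP ex;
    rewrite ex ey ?eqxx //.
  by rewrite oN ?oabc // uniq3 nab !(eq_sym _ c) nca ncb.
have := none (a, b); rewrite /= eqxx /= => /negbT/exists_inP[].
by exists c; rewrite ?inE.
Qed.

(** When the sign of a, b, c is positive, the induced edges are ab, bc, ca;
    each vertex is the head of one of them and the tail of another. *)
Lemma induced_edge_orients3 (T : finType) (x0 : T) o (S : {set T}) :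
  cyclic_sign o -> #|S| = 3 -> orients3 S (induced_edge x0 o S).
Proof.
move=> oS S3; have [a [b [c [u eS]]]] := cards3P S3.
wlog oabc : a b c u eS / o a b c.
  move=> IH; have [oabc | noabc] := boolP (o a b c); first exact: (IH a b c).
  apply: (IH b a c) => //; last by rewrite oS.2.
    by move: u; rewrite !uniq3 (eq_sym b a) => /and3P[-> -> ->].
  by rewrite eS (setUC [set b]).
have [nab nac nbc] : [/\ a != b, a != c & b != c].
  by apply/and3P; rewrite -uniq3.
have nca : c != a by rewrite eq_sym.
have eab : induced_edge x0 o S [set a; b] = (a, b).
  by apply: (induced_edgeE x0 oS nab _ oabc); rewrite eS set3D2.
have ebc : induced_edge x0 o S [set b; c] = (b, c).
  have obca : o b c a by rewrite -oS.1.
  apply: (induced_edgeE x0 oS nbc _ obca).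
  by rewrite eS -setUA setUC set3D2 // eq_sym.
have eca : induced_edge x0 o S [set c; a] = (c, a).
  have ocab : o c a b by rewrite oS.1.
  apply: (induced_edgeE x0 oS nca _ ocab).
  by rewrite eS setUC setUA set3D2 // eq_sym.
rewrite /orients3 S3 eqxx /=; apply/andP; split.
  apply/forall_inP => A AS; rewrite /orients2.
  have -> /= : #|A| == 2 by move: AS; rewrite inE => /andP[].
  by have := AS; rewrite {1}eS => /subsets2_of3[]->;
    rewrite ?eab ?ebc ?eca eqxx.
apply/forall_inP => A AS; apply/forall_inP => B BS.
apply/implyP => nAB; apply/forallP => x; apply/implyP => /eqP AB.
have: x \in A :&: B by rewrite AB set11.
have nba : b != a by rewrite eq_sym.
have ncb : c != b by rewrite eq_sym.
have neqs := (negbTE nab, negbTE nac, negbTE nbc,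
              negbTE nba, negbTE nca, negbTE ncb).
move: AS BS nAB; rewrite {1 2}eS => /subsets2_of3[]-> /subsets2_of3[]->;
  rewrite ?eqxx // ?eab ?ebc ?eca /edge_sign /= !inE
    => _ /andP[/orP[]/eqP-> /orP[]]; by rewrite ?eqxx ?neqs.
Qed.

Definition cyclic_tournament (T : finType) (x0 : T) o (oS : cyclic_sign o) :
    tournament3 T :=
  Tournament3 (fun S S3 => @induced_edge_orients3 T x0 o S oS S3).

(** Compatibility along xy asks for opposite signs because both triples are
    read with x, y in the same order. *)
Lemma directed_cyclic_tournament (T : finType) (x0 : T) o (oS : cyclic_sign o)
    (Q : {set T}) :
    #|Q| = 4 ->
    (forall x y z w, uniq [:: x; y; z; w] -> {subset [:: x; y; z; w] <= Q} ->
       o x y z != o x y w) ->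
  directed_tetrahedron (cyclic_tournament x0 oS) Q.
Proof.
move=> Q4 oQ; rewrite /directed_tetrahedron Q4 eqxx.
apply/forall_inP => S; rewrite inE => /andP[/subsetP SQ /eqP S3].
apply/forall_inP => S'; rewrite inE => /andP[/subsetP SQ' /eqP S3'].
apply/implyP => _; apply/implyP => /cards2P[x [y [nxy I]]]; rewrite I /=.
have [xS yS] : x \in S :&: S' /\ y \in S :&: S' by rewrite I !inE !eqxx orbT.
have /cards1P[z ez] : #|S :\: [set x; y]| == 1.
  by rewrite cardsD -I setIA setIid S3 I cards2 nxy.
have /cards1P[w ew] : #|S' :\: [set x; y]| == 1.
  by rewrite cardsD -I setIC -setIA setIid S3' I cards2 nxy.
have: z \in S :\: [set x; y] by rewrite ez set11.
have: w \in S' :\: [set x; y] by rewrite ew set11.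
rewrite !inE !negb_or => /andP[/andP[nwx nwy] wS'] /andP[/andP[nzx nzy] zS].
move: xS yS; rewrite !inE => /andP[xS xS'] /andP[yS yS'].
have nzw : z != w.
  apply: contraNneq nzx => zw; have: z \in S :&: S' by rewrite inE zS zw.
  by rewrite I !inE (negbTE nzy) orbF.
have u : uniq [:: x; y; z; w].
  by rewrite /= !inE !negb_or nxy nzw !(eq_sym _ z) !(eq_sym _ w) nzx nzy nwx nwy.
have sQ : {subset [:: x; y; z; w] <= Q}.
  by apply/allP; rewrite /= (SQ x) ?(SQ y) ?(SQ z) ?(SQ' w).
have nyx : y != x by rewrite eq_sym.
have uz : uniq [:: x; y; z] by rewrite uniq3 nxy !(eq_sym _ z) nzx nzy.
have uw : uniq [:: x; y; w] by rewrite uniq3 nxy !(eq_sym _ w) nwx nwy.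
have := oQ _ _ _ _ u sQ; case oz: (o x y z); case ow: (o x y w) => // _.
  have oyw : o y x w by rewrite oS.2 // ow.
  rewrite (induced_edgeE x0 oS nxy ez oz) (setUC [set x]).
  by rewrite (induced_edgeE x0 oS nyx _ oyw) ?xpair_eqE ?(negbTE nxy) // setUC.
have oyz : o y x z by rewrite oS.2 // oz.
rewrite (induced_edgeE x0 oS nxy ew ow) (setUC [set x]).
by rewrite (induced_edgeE x0 oS nyx _ oyz) ?xpair_eqE ?(negbTE nyx) // setUC.
Qed.

(** * The 3-tournament of a tournament *)

(** The tournament coded by [f]: the two values of [f] at a pair are added, so
    that toggling either one reverses the arc and no order of the pair has to
    be chosen.  The product space of all [f] makes averaging uniform. *)
Definition arc (n : nat) (f : {ffun 'I_n * 'I_n -> bool}) (x y : 'I_n) : bool :=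
  (x < y) (+) (f (x, y) (+) f (y, x)).

Lemma arcC n f (x y : 'I_n) : x != y -> arc f y x = ~~ arc f x y.
Proof.
by move=> nxy; rewrite /arc [f (y, x) (+) _]addbC -addNb -leqNgt ltn_neqAle
   eq_sym nxy.
Qed.

Definition spin (n : nat) (f : {ffun 'I_n * 'I_n -> bool}) (x y z : 'I_n) :=
  arc f x y (+) (arc f y z (+) arc f z x).

Lemma spin_cyclic_sign n (f : {ffun 'I_n * 'I_n -> bool}) : cyclic_sign (spin f).
Proof.
split=> [x y z | x y z]; rewrite /spin; first by rewrite addbC addbA.
rewrite uniq3 => /and3P[nxy nxz nyz].
rewrite (arcC f nxy) (arcC f nyz) (arcC f nxz).
by case: (arc f x y); case: (arc f y z); case: (arc f x z).
Qed.

Definition flip (n : nat) (e : 'I_n * 'I_n) (f : {ffun 'I_n * 'I_n -> bool}) :=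
  [ffun u => f u (+) (u == e)].

Lemma flip_inj n (e : 'I_n * 'I_n) : injective (flip e).
Proof.
by move=> f g /ffunP efg; apply/ffunP=> u; have := efg u; rewrite !ffunE => /addIb.
Qed.

Lemma arc_flip n (a b x y : 'I_n) f :
  arc (flip (a, b) f) x y =
  arc f x y (+) (((x == a) && (y == b)) (+) ((y == a) && (x == b))).
Proof.
rewrite /arc !ffunE !xpair_eqE.
by case: (x < y); case: (f _); case: (f _); case: (_ && _); case: (_ && _).
Qed.

(** For x = a the flip reverses no arc, so that the four choices of x are the
    four changes needed: none, or one of the three edges at a. *)
Lemma exists_flip_directed n (x0 : 'I_n) (Q : {set 'I_n}) (a : 'I_n) f :
    #|Q| = 4 -> a \in Q ->
  exists2 x, x \in Q &
    directed_tetrahedron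
      (cyclic_tournament x0 (spin_cyclic_sign (flip (a, x) f))) Q.
Proof.
move=> Q4 Qa; have := cardsD1 a Q; rewrite Qa Q4 => -[/esym/cards3P].
move=> [b [c [d [u eQ]]]].
have Qb : b \in Q :\ a by rewrite eQ !inE eqxx.
have Qc : c \in Q :\ a by rewrite eQ !inE eqxx orbT.
have Qd : d \in Q :\ a by rewrite eQ !inE eqxx orbT.
move: Qb Qc Qd; rewrite !inE => /andP[nba Qb] /andP[nca Qc] /andP[nda Qd].
move: u; rewrite uniq3 => /and3P[nbc nbd ncd].
have neqs := (negbTE nba, negbTE nca, negbTE nda,
              negbTE nbc, negbTE nbd, negbTE ncd,
              etrans (eq_sym _ _) (negbTE nba), etrans (eq_sym _ _) (negbTE nca),
              etrans (eq_sym _ _) (negbTE nda), etrans (eq_sym _ _) (negbTE nbc),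
              etrans (eq_sym _ _) (negbTE nbd), etrans (eq_sym _ _) (negbTE ncd)).
(* Whether the 4-cycles abcd, acbd and abdc are odd; arcs traversed backwards
   in the walk appear negated. *)
pose odd1 g := arc g a b (+) arc g b c (+) (arc g c d (+) ~~ arc g a d).
pose odd2 g := arc g a c (+) ~~ arc g b c (+) (arc g b d (+) ~~ arc g a d).
pose odd3 g := arc g a b (+) arc g b d (+) (~~ arc g c d (+) ~~ arc g a c).
pose all_odd g := [&& odd1 g, odd2 g & odd3 g].
have [x Qx /and3P[o1 o2 o3]] : exists2 x, x \in Q & all_odd (flip (a, x) f).
  have E x : x \in Q -> all_odd (flip (a, x) f) ->
      exists2 x, x \in Q & all_odd (flip (a, x) f) by exists x.
  (* Checked over the 64 values of the six arcs. *)
  move: (E a Qa) (E b Qb) (E c Qc) (E d Qd).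
  rewrite /all_odd /odd1 /odd2 /odd3 !arc_flip !eqxx !neqs /=.
  case: (arc f a b); case: (arc f a c); case: (arc f a d); case: (arc f b c);
    case: (arc f b d); case: (arc f c d) => /=; auto.
exists x => //; apply: directed_cyclic_tournament => //; move: (flip _ _) o1 o2 o3.
move=> g; rewrite /odd1 /odd2 /odd3 => o1 o2 o3 p q r s u sQ.
have mem t : t \in [:: p; q; r; s] -> [\/ t = a, t = b, t = c | t = d].
  move/sQ; rewrite -(setD1K Qa) eQ !inE -!orbA.
  by case/or4P=> /eqP->; [constructor 1|constructor 2|constructor 3|constructor 4].
(* What remains is to match each ordering of Q with one of the 4-cycles. *)
have := mem p; have := mem q; have := mem r; have := mem s.
rewrite !inE !eqxx !orbT /= => /(_ isT) ms /(_ isT) mr /(_ isT) mq /(_ isT) mp.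
have ba := arcC g nba; have ca := arcC g nca; have da := arcC g nda.
have cb := arcC g nbc; have db := arcC g nbd; have dc := arcC g ncd.
rewrite /spin; move: u o1 o2 o3 {sQ mem}.
by case: mp => ->; case: mq => ->; rewrite /= !inE ?eqxx //=;
  case: mr => ->; rewrite ?eqxx ?orbT ?andbF //=;
  case: ms => ->; rewrite ?eqxx ?orbT ?andbF //= => _;
  rewrite ?cb ?db ?dc ?ba ?ca ?da;
  case: (arc g b a); case: (arc g c a); case: (arc g d a);
  case: (arc g b c); case: (arc g b d); case: (arc g c d).
Qed.

(** * Averaging over all tournaments *)

Lemma card_directed_codes n (x0 : 'I_n) (Q : {set 'I_n}) : #|Q| = 4 ->
  #|{ffun 'I_n * 'I_n -> bool}| <=
    4 * #|[set f | directed_tetrahedron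
                     (cyclic_tournament x0 (spin_cyclic_sign f)) Q]|.
Proof.
move=> Q4; have /set0Pn[a Qa] : Q != set0 by rewrite -card_gt0 Q4.
rewrite -{1}Q4; apply: (leq_card_translates (h := fun x => flip (a, x))).
  by move=> x; apply: flip_inj.
move=> f; have [x Qx dir] := exists_flip_directed x0 f Q4 Qa.
by exists x => //; rewrite inE.
Qed.

(** Counting pairs of a tournament and a tetrahedron directed by it shows that
    the average, hence the maximum, of directed tetrahedra is large enough. *)
Lemma exists_many_directed n (x0 : 'I_n) :
  exists t : tournament3 'I_n, 'C(n, 4) <= 4 * #|directed_tetrahedra t|.
Proof.
pose F : finType := {ffun 'I_n * 'I_n -> bool}.
pose t (f : F) := cyclic_tournament x0 (spin_cyclic_sign f).
have avg : #|F| * 'C(n, 4) <= \sum_(f : F) 4 * #|directed_tetrahedra (t f)|.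
  have -> : \sum_(f : F) 4 * #|directed_tetrahedra (t f)| =
      \sum_(Q : {set 'I_n}) 4 * #|[set f : F | directed_tetrahedron (t f) Q]|.
    rewrite -!big_distrr /=; congr (_ * _).
    under eq_bigr => f _ do rewrite -sum1_card.
    under [RHS]eq_bigr => Q _ do rewrite -sum1_card.
    rewrite (exchange_big_dep predT) //=; apply: eq_bigr => Q _.
    by apply: eq_bigl => f; rewrite !inE.
  rewrite mulnC -{1}(card_ord n) -card_draws -sum_nat_const.
  rewrite [X in _ <= X](bigID (mem [set Q : {set 'I_n} | #|Q| == 4])) /=.
  apply: leq_trans (leq_addr _ _); apply: leq_sum => Q; rewrite inE => /eqP Q4.
  exact: card_directed_codes.
have f0 : F := [ffun=> false].
case: (@arg_maxnP F f0 predT (fun f => 4 * #|directed_tetrahedra (t f)|)) => //.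
move=> f _ f_max; exists (t f); have F_gt0 : 0 < #|F| by apply/card_gt0P; exists f.
rewrite -(leq_pmul2l F_gt0); apply: leq_trans avg _.
by rewrite -sum_nat_const; apply: leq_sum => g _; apply: f_max.
Qed.

Theorem theorem2p2 (n : nat) (hn : (4 <= n)%N) :
  exists t : tournament3 'I_n,
    ((1 / 4%:R) * 'C(n, 4)%:R <= #|directed_tetrahedra t|%:R :> rat)%R.
Proof.
have [t le_t] := exists_many_directed (Ordinal (leq_trans (isT : 0 < 4) hn)).
exists t; rewrite GRing.mul1r GRing.mulrC Num.Theory.ler_pdivrMr //.
rewrite -GRing.natrM Num.Theory.ler_nat mulnC.
exact: le_t.
Qed.
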